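(* Let $(M,\widetilde B)$ be a strict root of unity quantum seed with respect to a skew-symmetric integer matrix $\Lambda$, $(M_q,\widetilde B)$ the associated quantum seed, and $\mathrm{inv}\subseteq[1,N]\setminus\mathrm{ex}$. If $\mathcal A_q(M_q,\widetilde B,\mathrm{inv})=\mathcal U_q(M_q,\widetilde B,\mathrm{inv})$, then $\mathcal A_q(M_q,\widetilde B,\mathrm{inv})/(\Phi_\ell(q^{1/2}))\cong\mathcal A_\varepsilon(M,\widetilde B,\mathrm{inv})$, and the specialization map $\eta_\varepsilon:\mathcal A_q(M_q,\widetilde B,\mathrm{inv})\to\mathcal A_q(M_q,\widetilde B,\mathrm{inv})/(\Phi_\ell(q^{1/2}))$ is the restriction to $\mathcal A_q(M_q,\widetilde B,\mathrm{inv})$ of the specialization map $\kappa_\varepsilon:\mathcal T_q(M_q)_\ge\to\mathcal T_\varepsilon(M)_\ge$.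
   Context: Root of unity setting: $\ell$ a positive integer, $\mathbb Z_\ell=\mathbb Z/\ell\mathbb Z$, $\varepsilon^{1/2}\in\mathbb C$ a primitive $\ell$-th root of unity, $\mathcal A^{1/2}_\varepsilon=\mathbb Z[\varepsilon^{1/2}]$, $\varepsilon^{a/2}=(\varepsilon^{1/2})^a$; $\overline C$ = reduction mod $\ell$; $e_1,\dots,e_N$ standard basis. For skew-symmetric $\Lambda:\mathbb Z^N\times\mathbb Z^N\to\mathbb Z_\ell$, $\mathcal T_\varepsilon(\Lambda)$ has $\mathcal A^{1/2}_\varepsilon$-basis $X^f$ with $X^fX^g=\varepsilon^{\Lambda(f,g)/2}X^{f+g}$; a root of unity toric frame of a division algebra $\mathcal F$ over $\mathbb Q(\varepsilon^{1/2})$ is $M:\mathbb Z^N\to\mathcal F$ with $f\mapsto M(f)$ extending to an injective algebra map from some (unique) $\mathcal T_\varepsilon(\Lambda_M)$ whose image $\mathcal T_\varepsilon(M)$ generates $\mathcal F$ as a skew field. Fix $\mathrm{ex}\subseteq[1,N]$; $\widetilde B=(b_{ij})$ integer, rows $[1,N]$, columns $\mathrm{ex}$, principal part $B$, columns $b^k$. $\ell$-compatibility w.r.t. $D=\mathrm{diag}(d_j)_{j\in\mathrm{ex}}$ ($d_j>0$): $DB$ skew-symmetric and $\sum_k\overline b_{kj}(\Lambda_M)_{ki}=\delta_{ij}\overline d_j$ mod $\ell$; seeds are such pairs; mutation $\mu_k$: $\mu_k(\widetilde B)$ has entries $-b_{ij}$ if $i=k$ or $j=k$, else $b_{ij}+(|b_{ik}|b_{kj}+b_{ik}|b_{kj}|)/2$;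 $\mu_k(M)$ is the frame with matrix $\overline E^\top\Lambda_M\overline E$ ($e_{ij}=\delta_{ij}$ for $j\ne k$, $e_{kk}=-1$, $e_{ik}=\max(0,-b_{ik})$), $\mu_k(M)(e_j)=M(e_j)$ ($j\ne k$), $\mu_k(M)(e_k)=M(-e_k+[b^k]_+)+M(-e_k-[b^k]_-)$ ($[b]_\pm$ keeps entries with $\pm b_i\ge0$). $\mathcal A_\varepsilon(M,\widetilde B,\mathrm{inv})$ is the $\mathcal A^{1/2}_\varepsilon$-algebra generated by all cluster variables $M'(e_i)$ of mutation-equivalent seeds and $M(e_j)^{-1}$, $j\in\mathrm{inv}$. Quantum setting: $\mathcal A^{1/2}_q=\mathbb Z[q^{\pm1/2}]$; $\mathcal T_q(\Lambda)$ for skew-symmetric integer $\Lambda$ has basis $X^f$ with $X^fX^g=q^{\Lambda(f,g)/2}X^{f+g}$; toric frames $M_q$, compatibility ($\sum_kb_{kj}\lambda_{ki}=\delta_{ij}d_j$), quantum seeds, mutations and $\mathcal A_q(M_q,\widetilde B,\mathrm{inv})$ are defined analogously over $\mathcal A^{1/2}_q$; $\mathcal U_q(M_q,\widetilde B,\mathrm{inv})$ is the intersection over all quantum seeds $(M'_q,\widetilde B')$ mutation-equivalent to $(M_q,\widetilde B)$ of $\mathcal T_q(M'_q)_\ge$, where $\mathcal T_q(M'_q)_\ge$ is the subalgebra generated by $M'_q(e_i)$, $i\in[1,N]$, and $M'_q(e_j)^{-1}$, $j\in\mathrm{ex}\sqcup\mathrm{inv}$; $\mathcal T_\varepsilon(M)_\ge$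 is defined likewise. Strictness: $(M,\widetilde B)$ is strict w.r.t. skew-symmetric $\Lambda\in M_N(\mathbb Z)$ if $\overline\Lambda=\Lambda_M$ and $(\Lambda,\widetilde B)$ is compatible w.r.t. the same $D$; the associated quantum seed is $(M_q,\widetilde B)$ in $\mathrm{Fract}(\mathcal T_q(\Lambda))$ with $M_q(f)=X^f$. $\Phi_\ell$ is the $\ell$-th cyclotomic polynomial; $\kappa_\varepsilon:\mathcal T_q(M_q)_\ge\to\mathcal T_\varepsilon(M)_\ge$ is the ring surjection $q^{1/2}\mapsto\varepsilon^{1/2}$, $M_q(f)\mapsto M(f)$, with kernel $(\Phi_\ell(q^{1/2}))$. *)

(* Defs.v *)
From HB Require Import structures.
From mathcomp Require Import all_boot all_order all_algebra all_field.
Set Implicit Arguments. Unset Strict Implicit. Unset Printing Implicit Defensive.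
Import Order.TTheory GRing.Theory Num.Theory.
Local Open Scope ring_scope.

Definition peval (R : unitRingType) (p : {poly int}) (t : R) : R :=
  (map_poly (fun c : int => c%:~R) p).[t].

Section ClusterDefs.
Variable N : nat.
Local Notation vec := 'rV[int]_N.
Local Notation mat := 'M[int]_N.

Definition bil (L : mat) (f g : vec) : int := (f *m L *m g^T) 0 0.
Definition evec (i : 'I_N) : vec := delta_mx 0 i.
Definition posp (b : vec) : vec := \row_i Num.max (b 0 i) 0.
Definition negp (b : vec) : vec := \row_i Num.min (b 0 i) 0.
Definition bcol (B : mat) (k : 'I_N) : vec := \row_i B i k.

(* B~ is stored as an N x N integer matrix; only columns j \in ex are used. *)
Definition mutB (k : 'I_N) (B : mat) : mat :=
  \matrix_(i, j) if (i == k) || (j == k) then - B i j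
                 else B i j + ((`|B i k| * B k j + B i k * `|B k j|) %/ 2)%Z.

Definition mutE (k : 'I_N) (B : mat) : mat :=
  \matrix_(i, j) if j != k then (i == j)%:Z
                 else if i == k then -1 else Num.max 0 (- B i k).

Definition mutL (k : 'I_N) (B L : mat) : mat := (mutE k B)^T *m L *m mutE k B.

Section Ring.
Variable R : unitRingType.

(* The toric frame with matrix L determined by its values x_i = M(e_i):
   M(f) = t^{- sum_{i<j} L_ij f_i f_j} x_1^{f_1} ... x_N^{f_N}, t = q^{1/2}. *)
Definition frameOf (t : R) (L : mat) (x : 'I_N -> R) (f : vec) : R :=
  t ^ (- \sum_(i < N) \sum_(j < N | (i < j)%N) L i j * f 0 i * f 0 j)
  * \prod_(i < N) x i ^ f 0 i.

(* a seed: cluster (values M(e_i)), matrix of the frame, exchange matrix *)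
Record seed := Seed { sx : 'I_N -> R; sL : mat; sB : mat }.

Definition mutS (t : R) (k : 'I_N) (s : seed) : seed :=
  Seed (fun j => if j == k then
          frameOf t (sL s) (sx s) (- evec k + posp (bcol (sB s) k))
        + frameOf t (sL s) (sx s) (- evec k - negp (bcol (sB s) k))
        else sx s j)
       (mutL k (sB s) (sL s)) (mutB k (sB s)).

Definition mut_equiv (t : R) (ex : {set 'I_N}) (s s' : seed) : Prop :=
  exists ks : seq 'I_N, all (fun k => k \in ex) ks /\
    s' = foldl (fun s0 k => mutS t k s0) s ks.

Definition subring_closed (P : R -> Prop) : Prop :=
  [/\ P 0, P 1, (forall a b, P a -> P b -> P (a + b)),
      (forall a, P a -> P (- a)) & (forall a b, P a -> P b -> P (a * b))].

Definition division_closed (P : R -> Prop) : Prop :=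
  subring_closed P /\ (forall a, P a -> a != 0 -> P a^-1).

Definition gen_subring (S : R -> Prop) (y : R) : Prop :=
  forall P, subring_closed P -> (forall a, S a -> P a) -> P y.

Definition is_division_ring : Prop := forall x : R, x != 0 -> x \is a GRing.unit.
Definition central (t : R) : Prop := forall x : R, t * x = x * t.


Definition clusterAlg (t : R) (ex inv : {set 'I_N}) (s0 : seed) : R -> Prop :=
  gen_subring (fun a => [\/ a = t, a = t^-1,
     (exists s' i, mut_equiv t ex s0 s' /\ a = sx s' i) |
     (exists j, j \in inv /\ a = (sx s0 j)^-1)]).

Definition Tge (t : R) (ex inv : {set 'I_N}) (s : seed) : R -> Prop :=
  gen_subring (fun a => [\/ a = t, a = t^-1, (exists i, a = sx s i) |
     (exists j, j \in ex :|: inv /\ a = (sx s j)^-1)]).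

Definition upperAlg (t : R) (ex inv : {set 'I_N}) (s0 : seed) (y : R) : Prop :=
  forall s', mut_equiv t ex s0 s' -> Tge t ex inv s' y.

(* M is a toric frame of R (over Z[t^{+-1}], t = q^{1/2} generic) with matrix L *)
Definition is_qframe (t : R) (L : mat) (M : vec -> R) : Prop :=
  [/\ M 0 = 1,
      (forall f g, M f * M g = t ^ bil L f g * M (f + g)),
      (forall (s : seq vec) (c : vec -> {poly int}), uniq s ->
         \sum_(f <- s) peval (c f) t * M f = 0 -> forall f, f \in s -> c f = 0) &
      (forall P : R -> Prop, division_closed P -> P t -> (forall f, P (M f)) ->
         forall y, P y)].

(* M is a root of unity toric frame of R (over Z[z], z = eps^{1/2}, identified
   with Z[e] for e : algC) whose matrix is L mod l *)
Definition is_eframe (z : R) (e : algC) (L : mat) (M : vec -> R) : Prop :=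
  [/\ M 0 = 1,
      (forall f g, M f * M g = z ^ bil L f g * M (f + g)),
      (forall (s : seq vec) (c : vec -> {poly int}), uniq s ->
         \sum_(f <- s) peval (c f) z * M f = 0 ->
         forall f, f \in s -> peval (c f) e = 0) &
      (forall P : R -> Prop, division_closed P -> P z -> (forall f, P (M f)) ->
         forall y, P y)].

End Ring.
End ClusterDefs.

(* Main.v *)
Require Import Defs.
From HB Require Import structures.
From mathcomp Require Import all_boot all_order all_algebra all_field.
From mathcomp Require Import zify ring.
Import Order.TTheory GRing.Theory Num.Theory.
Local Open Scope ring_scope.

(** Running the same mutations on both sides, [kappa] sends quantum cluster
    variables to root of unity cluster variables: apply [kappa] to the exchange
    relation, whose right-hand side involves only nonnegative exponents, and
    cancel the old variable.  This needs root of unity cluster variables to be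
    nonzero, which holds because monomial independence is inherited by mutated
    frames: ordering exponents by the pairing with the exchange column [b], a
    mutated monomial has a leading term that is a monomial of the old frame.
    For the kernel, let [x] be in [A_q = U_q] with [kappa x = 0].  In every seed,
    [x] times some monomial is a combination of cluster monomials; applying
    [kappa] and independence, every coefficient vanishes at [e], hence is
    divisible by [Phi_l(t)].  So [Phi_l(t)^-1 x] lies in every [T_q(M'_q)_>=],
    that is, in [U_q = A_q]. *)

(** * Matrix mutation and compatibility *)

Section IntegerMatrices.
Context {N : nat}.
Implicit Types (L B : 'M[int]_N) (f g h : 'rV[int]_N) (i j k : 'I_N).

Lemma bilDl L f g h : bil L (f + g) h = bil L f h + bil L g h.
Proof. by rewrite /bil !mulmxDl mxE. Qed.

Lemma bilDr L f g h : bil L f (g + h) = bil L f g + bil L f h.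
Proof. by rewrite /bil linearD mulmxDr mxE. Qed.

Lemma bilNl L f g : bil L (- f) g = - bil L f g.
Proof. by rewrite /bil !mulNmx mxE. Qed.

Lemma bilNr L f g : bil L f (- g) = - bil L f g.
Proof. by rewrite /bil linearN mulmxN mxE. Qed.

Lemma bilZl L a f g : bil L (a *: f) g = a * bil L f g.
Proof. by rewrite /bil -!scalemxAl mxE. Qed.

Lemma bil0l L g : bil L 0 g = 0.
Proof. by rewrite /bil !mul0mx mxE. Qed.

Lemma bilC L f g : L^T = - L -> bil L g f = - bil L f g.
Proof.
move=> sL; have -> : bil L g f = (g *m L *m f^T)^T 0 0 by rewrite mxE.
by rewrite !trmx_mul trmxK sL mulNmx mulmxN mulmxA mxE.
Qed.

Lemma bilff L f : L^T = - L -> bil L f f = 0.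
Proof. by move/(bilC L f f)=> h; lia. Qed.

Lemma bil_sum L f g : bil L f g = \sum_i \sum_j L i j * f 0 i * g 0 j.
Proof.
rewrite /bil mxE exchange_big /=; apply: eq_bigr => j _.
rewrite !mxE mulr_suml; apply: eq_bigr => i _.
by rewrite (mulrC (f 0 i)).
Qed.

Lemma evecE i j : evec i 0 j = (i == j)%:Z.
Proof. by rewrite mxE eqxx /= eq_sym; case: eqP. Qed.

Lemma bil_evec L i j : bil L (evec i) (evec j) = L i j.
Proof.
rewrite bil_sum (bigD1 i) //= [X in _ + X]big1 ?addr0; last first.
  move=> a /negPf na; rewrite big1 // => b _.
  by rewrite evecE [i == a]eq_sym na mulr0 mul0r.
rewrite (bigD1 j) //= big1 ?addr0 ?evecE ?eqxx ?mulr1 // => a /negPf na.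
by rewrite evecE [j == a]eq_sym na mulr0.
Qed.

Lemma mul_evec f (E : 'M[int]_N) j : (f *m E^T) 0 j = \sum_i f 0 i * E j i.
Proof. by rewrite mxE; apply: eq_bigr => i _; rewrite mxE. Qed.

Lemma evec_mul i (E : 'M[int]_N) j : (evec i *m E^T) 0 j = E j i.
Proof.
rewrite mul_evec (bigD1 i) //= evecE eqxx mul1r big1 ?addr0 // => a /negPf na.
by rewrite evecE [i == a]eq_sym na mul0r.
Qed.

Lemma bil_mutL k B L f g :
  bil (mutL k B L) f g = bil L (f *m (mutE k B)^T) (g *m (mutE k B)^T).
Proof. by rewrite /bil /mutL trmx_mul trmxK !mulmxA. Qed.

(** The numerator [|a| b + a |b|] is twice the product of the positive parts minus the product of
    the negative parts, so the division by 2 is exact. The sign-split form is the one to which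
    [pos_neg_scale] applies. *)
Lemma mutBE k B i j : i != k -> j != k ->
  mutB k B i j = B i j + Num.max (B i k) 0 * Num.max (B k j) 0
                       - Num.min (B i k) 0 * Num.min (B k j) 0.
Proof.
move=> /negPf ik /negPf jk; rewrite mxE ik jk /= -addrA; congr (_ + _).
set a := B i k; set b := B k j; clearbody a b.
suff -> : `|a| * b + a * `|b| = (Num.max a 0 * Num.max b 0 - Num.min a 0 * Num.min b 0) * 2.
  by rewrite mulzK.
case: (lerP a 0) => ha; case: (lerP b 0) => hb.
- by rewrite !ler0_norm //; ring.
- by rewrite ler0_norm // gtr0_norm //; ring.
- by rewrite gtr0_norm // ler0_norm //; ring.
- by rewrite !gtr0_norm //; ring.
Qed.

Lemma max_add_min (a : int) : Num.max a 0 + Num.min a 0 = a.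
Proof. by case: lerP; rewrite ?addr0 ?add0r. Qed.

Lemma max0N (a : int) : Num.max 0 (- a) = - Num.min a 0.
Proof. by rewrite oppr_min oppr0 maxC. Qed.

(** The relation forces [x] and [y] to have opposite signs, so the positive part of one matches the
    negative part of the other. This carries skew-symmetrizability through the sign-split mutation
    formula. *)
Lemma pos_neg_scale (a b : nat) (x y : int) : (0 < a)%N -> (0 < b)%N ->
  a%:Z * x = - (b%:Z * y) ->
  a%:Z * Num.max x 0 = - (b%:Z * Num.min y 0) /\
  a%:Z * Num.min x 0 = - (b%:Z * Num.max y 0).
Proof.
move=> a0 b0 e.
case: (lerP x 0) => hx; case: (lerP y 0) => hy; rewrite ?mulr0 ?oppr0 //; split=> //; nia.
Qed.

End IntegerMatrices.

(** * Compatible pairs and their mutation *)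

Section Compatible.
Context {N : nat}.
Variables (ex : {set 'I_N}) (d : 'I_N -> nat).
Implicit Types (L B : 'M[int]_N) (f g h v : 'rV[int]_N) (i j k : 'I_N).

(** By strictness the root of unity seed carries the same integer matrix, so this one invariant
    follows both mutation sequences. *)
Definition compatible L B : Prop :=
  [/\ L^T = - L, forall j, j \in ex -> (0 < d j)%N,
      forall i j, i \in ex -> j \in ex -> (d i)%:Z * B i j = - ((d j)%:Z * B j i) &
      forall i j, j \in ex -> \sum_(k < N) B k j * L k i = (i == j)%:Z * (d j)%:Z].

Variables (L B : 'M[int]_N) (LB : compatible L B).

Lemma compatible_diag k : k \in ex -> B k k = 0.
Proof.
case: LB => _ dp sB _ kex; have := sB k k kex kex; have := dp k kex; nia.
Qed.

(** Compatibility extended linearly in the second argument. It makes [bcol B k] pair to zero with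
    [evec j] for [j != k], so the two exchange monomials commute alike with the other variables. *)
Lemma bil_bcol k v : k \in ex -> bil L (bcol B k) v = (d k)%:Z * v 0 k.
Proof.
case: LB => _ _ _ cB kex; rewrite bil_sum exchange_big /= (bigD1 k) //=.
rewrite [X in _ + X]big1 ?addr0; last first.
  move=> j /negPf jk; rewrite -mulr_suml.
  transitivity ((\sum_i B i k * L i j) * v 0 j); last by rewrite cB // jk !mul0r.
  by congr (_ * _); apply: eq_bigr => i _; rewrite mxE mulrC.
rewrite -mulr_suml; congr (_ * _).
transitivity (\sum_i B i k * L i k); last by rewrite cB // eqxx mul1r.
by apply: eq_bigr => i _; rewrite mxE mulrC.
Qed.

Lemma bcol_neq0 k : k \in ex -> bcol B k != 0.
Proof.
move=> kex; apply/eqP => b0; have := bil_bcol k (evec k) kex.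
case: LB => _ dp _ _; have := dp k kex.
rewrite b0 bil0l evecE eqxx; lia.
Qed.

Lemma posp_negp (b : 'rV[int]_N) : posp b = - negp b + b.
Proof. by apply/rowP => i; rewrite !mxE -{3}(max_add_min (b 0 i)) addrCA addNr addr0. Qed.

Lemma evec_mutE_neq k i : i != k -> evec i *m (mutE k B)^T = evec i.
Proof.
by move=> ik; apply/rowP => j; rewrite evec_mul !mxE ik eqxx /= eq_sym; case: eqP => // ->.
Qed.

Lemma evec_mutE_eq k : k \in ex ->
  evec k *m (mutE k B)^T = - evec k - negp (bcol B k).
Proof.
move=> kex; apply/rowP => j; rewrite evec_mul !mxE eqxx /=.
case: eqP => [->|]; first by rewrite compatible_diag // minxx; lia.
by move=> _; rewrite mulr0n oppr0 add0r max0N.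
Qed.

Lemma mul_mutE k f i : k \in ex ->
  (f *m (mutE k B)^T) 0 i = f 0 i - f 0 k * ((i == k)%:Z * 2 + Num.min (B i k) 0).
Proof.
move=> kex; rewrite mul_evec (bigD1 k) //=.
have [->|ik] := eqVneq i k.
  rewrite big1 ?addr0; first by rewrite mxE !eqxx /= compatible_diag // minxx; ring.
  by move=> j /negPf jk; rewrite mxE jk eq_sym jk /= mulr0.
rewrite (bigD1 i) //= big1 ?addr0; last first.
  by move=> j /andP[jk /negPf ji]; rewrite mxE jk eq_sym ji mulr0.
by rewrite !mxE !eqxx ik (negPf ik) /= max0N; ring.
Qed.

(** Coordinate [k] is negated, hence recovered, and the correction to the other coordinates depends
    only on it. *)
Lemma mul_mutE_inj k : k \in ex -> injective (fun f => f *m (mutE k B)^T).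
Proof.
move=> kex f g /rowP e; apply/rowP => i.
have := e i; have := e k; rewrite !mul_mutE // eqxx compatible_diag // minxx.
set m := Num.min _ _ => e1.
have -> : f 0 k = g 0 k by lia.
by move/addIr.
Qed.

Lemma bcolE (A : 'M[int]_N) k i : bcol A k 0 i = A i k.
Proof. by rewrite mxE. Qed.

(** In old coordinates the mutated columns are combinations of old columns, so pairings with them
    are evaluated by [bil_bcol] in the old seed. *)
Lemma bcol_mutB k j : k \in ex ->
  bcol (mutB k B) j *m (mutE k B)^T =
  if j == k then - bcol B k else bcol B j + Num.max (B k j) 0 *: bcol B k.
Proof.
move=> kex; apply/rowP => i; rewrite mul_mutE // !bcolE.
have [->|jk] := eqVneq j k.
  by rewrite !mxE !eqxx !orbT compatible_diag // oppr0 mul0r subr0.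
have [->|ik] := eqVneq i k.
  by rewrite !mxE !eqxx /= compatible_diag // minxx; ring.
rewrite mutBE // !mxE eqxx /=.
have := max_add_min (B i k); have := max_add_min (B k j).
set p := Num.max _ _; set q := Num.min _ _; set r := Num.max _ _; set u := Num.min _ _.
by move=> <- <-; ring.
Qed.

Lemma mut_compatible k : k \in ex -> compatible (mutL k B L) (mutB k B).
Proof.
move=> kex; have [sL dp sB cB] := LB; split=> //.
- by rewrite /mutL !trmx_mul trmxK sL mulNmx mulmxN mulmxA.
- move=> i j iex jex.
  have [->|ik] := eqVneq i k; first by rewrite !mxE eqxx orbT /= mulrN sB // mulrN.
  have [->|jk] := eqVneq j k; first by rewrite !mxE eqxx orbT /= mulrN sB // mulrN.
  rewrite !mutBE //.
  have [ik1 ik2] := pos_neg_scale _ _ _ _ (dp _ iex) (dp _ kex) (sB _ _ iex kex).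
  have [jk1 jk2] := pos_neg_scale _ _ _ _ (dp _ jex) (dp _ kex) (sB _ _ jex kex).
  rewrite !(mulrDr, mulrBr, mulrN) !mulrA ik1 ik2 jk1 jk2 sB //.
  have e1 : (d k)%:Z * Num.min (B k i) 0 * Num.max (B k j) 0
     = - ((d j)%:Z * Num.min (B j k) 0) * Num.min (B k i) 0 by rewrite jk2; ring.
  have e2 : (d k)%:Z * Num.max (B k i) 0 * Num.min (B k j) 0
     = - ((d j)%:Z * Num.max (B j k) 0) * Num.max (B k i) 0 by rewrite jk1; ring.
  rewrite !mulNr e1 e2 jk1 jk2; ring.
move=> i j jex.
(* The sum is read as a pairing of column [j] with [evec i], which [bil_mutL] moves to the old
   seed. *)
have -> : \sum_k0 mutB k B k0 j * mutL k B L k0 i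
        = bil (mutL k B L) (bcol (mutB k B) j) (evec i).
  rewrite bil_sum exchange_big [RHS](bigD1 i) //= [X in _ = _ + X]big1 ?addr0.
    by apply: eq_bigr => a _; rewrite bcolE evecE eqxx mulr1 mulrC.
  by move=> a /negPf ai; rewrite big1 // => b _; rewrite evecE [i == a]eq_sym ai mulr0.
rewrite bil_mutL bcol_mutB //.
have [->|ik] := eqVneq i k.
  rewrite evec_mutE_eq //; have [->|jk] := eqVneq j k.
    by rewrite bilNl bil_bcol // !mxE !eqxx compatible_diag // minxx; ring.
  rewrite bilDl bilZl !bil_bcol // !mxE !eqxx /= compatible_diag // minxx (negPf jk) /=.
  (* For [i = k] and [j != k] the contributions of the two columns must cancel; this is the exchange
     of positive and negative parts. *)
  have [jk1 jk2] := pos_neg_scale _ _ _ _ (dp _ jex) (dp _ kex) (sB _ _ jex kex).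
  transitivity (- ((d j)%:Z * Num.min (B j k) 0) - (d k)%:Z * Num.max (B k j) 0);
    last by rewrite jk2 mul0r; ring.
  by rewrite oppr0 sub0r subr0 mulrN1 !mulrN [in RHS]mulrC [(d k)%:Z * _]mulrC mulrC.
rewrite evec_mutE_neq //; case: ifP => [/eqP->|jk].
  by rewrite bilNl bil_bcol // evecE (negPf ik) mulr0 mul0r oppr0.
rewrite bilDl bilZl !bil_bcol // !evecE (negPf ik) !mulr0 addr0; exact: mulrC.
Qed.
End Compatible.

(** * Toric frames *)

Section ToricFrames.
Context {N : nat} {R : unitRingType}.
Variables (t : R).
Hypotheses (ct : central t) (ut : t \is a GRing.unit).
Implicit Types (L B : 'M[int]_N) (f g h : 'rV[int]_N) (i j k : 'I_N) (x : 'I_N -> R).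
Implicit Types (M : 'rV[int]_N -> R) (a b n : int) (u v w : R).

Lemma central_exp a u : t ^ a * u = u * t ^ a.
Proof. by apply: commr_sym; apply: commrXz; apply: commr_sym; exact: ct. Qed.

Lemma expD a b : t ^ (a + b) = t ^ a * t ^ b.
Proof. exact: exprzDr. Qed.

Lemma expK a : t ^ a * t ^ (- a) = 1.
Proof. by rewrite -expD subrr. Qed.

Lemma quasi_comm_expl a b u v : u \is a GRing.unit ->
  u * v = t ^ a * (v * u) -> u ^ b * v = t ^ (a * b) * (v * u ^ b).
Proof.
move=> uu uv.
have nat_case (m : nat) : u ^ m * v = t ^ (a * m) * (v * u ^ m).
  elim: m => [|m IH]; first by rewrite mulr0 !expr0z !mul1r mulr1.
  rewrite exprSz -[u * _ * v]mulrA IH mulrA -central_exp -[_ * u * _]mulrA.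
  rewrite [u * _]mulrA uv -!mulrA mulrA -expD; congr (t ^ _ * _); lia.
case: (intP b) => [|m|m]; [exact: (nat_case 0%N)|exact: nat_case|].
have um : u ^ (m.+1) \is a GRing.unit by exact: unitrXz.
apply: (mulrI um); rewrite mulrA -exprzDr // subrr mul1r.
rewrite [RHS]mulrA -central_exp -[_ * u ^ _ * _]mulrA [u ^ _ * _]mulrA nat_case.
by rewrite -!mulrA -exprzDr // subrr mulr1 mulrA mulrN -expD addNr mul1r.
Qed.

Lemma quasi_comm_exp a b c u v : u \is a GRing.unit -> v \is a GRing.unit ->
  u * v = t ^ a * (v * u) -> u ^ b * v ^ c = t ^ (a * b * c) * (v ^ c * u ^ b).
Proof.
move=> uu uv /(quasi_comm_expl a b _ _ uu) e.
have e' : v * u ^ b = t ^ (- (a * b)) * (u ^ b * v).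
  by rewrite e mulrA -expD addNr mul1r.
by rewrite (quasi_comm_expl _ c _ _ uv e') mulrA -expD mulNr subrr mul1r.
Qed.

Definition toric L M : Prop :=
  M 0 = 1 /\ forall f g, M f * M g = t ^ bil L f g * M (f + g).

(** Reversing [M f * M g] costs [t] to the difference of two opposite pairings, hence the doubled
    exponent. *)
Definition quasi_comm L x : Prop :=
  (forall i, x i \is a GRing.unit) /\
  forall i j, x i * x j = t ^ (L i j *+ 2) * (x j * x i).

Lemma toric_unit L M f : L^T = - L -> toric L M -> M f \is a GRing.unit.
Proof.
move=> sL [M0 MM]; apply/unitrP; exists (M (- f)).
by rewrite !MM bilNl bilNr bilff // oppr0 expr0z !mul1r addNr subrr.
Qed.

Lemma toric_inv L M f : L^T = - L -> toric L M -> (M f)^-1 = M (- f).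
Proof.
move=> sL tM; have uf := toric_unit L M f sL tM; have [M0 MM] := tM.
by apply: (mulrI uf); rewrite divrr // MM bilNr bilff // oppr0 expr0z mul1r subrr.
Qed.

Lemma toricD L M f g : toric L M -> M (f + g) = t ^ (- bil L f g) * (M f * M g).
Proof. by move=> [_ ->]; rewrite mulrA -expD addNr mul1r. Qed.

Lemma toric_quasi_comm L M f g : L^T = - L -> toric L M ->
  M f * M g = t ^ (bil L f g *+ 2) * (M g * M f).
Proof.
move=> sL [M0 MM]; rewrite !MM addrC mulrA -expD; congr (t ^ _ * _).
by rewrite (bilC L f g) // mulr2n addrK.
Qed.

Lemma vec_ind (P : 'rV[int]_N -> Prop) : P 0 -> (forall i, P (evec i)) ->
  (forall f g, P f -> P g -> P (f + g)) -> (forall f, P f -> P (- f)) -> forall f, P f.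
Proof.
move=> P0 Pe PD PN f; rewrite [f]row_sum_delta.
apply: (big_ind P) => // i _; rewrite -/(evec i).
have Pn (m : nat) : P (evec i *+ m) by elim: m => // m; rewrite mulrS; apply: PD.
case: (intP (f 0 i)) => [|m|m].
- by rewrite scale0r.
- by rewrite -[Posz _]natz scaler_nat.
- by rewrite scaleNr -[Posz _]natz scaler_nat; apply: PN.
Qed.

Lemma toric_unique L M M' : L^T = - L -> toric L M -> toric L M' ->
  (forall i, M (evec i) = M' (evec i)) -> forall f, M f = M' f.
Proof.
move=> sL tM tM' e; apply: vec_ind => //; first by rewrite tM.1 tM'.1.
- by move=> f g ef eg; rewrite (toricD L M) // (toricD L M') // ef eg.
- by move=> f ef; rewrite -(toric_inv L M) // -(toric_inv L M') // ef.
Qed.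

(** The ordered product of [frameOf], along any list of indices so that induction on the list is
    possible. *)
Definition omono x (r : seq 'I_N) f : R := \prod_(i <- r) x i ^ f 0 i.

Lemma omono_swap L x r f i a : quasi_comm L x ->
  omono x r f * x i ^ a
  = t ^ (\sum_(j <- r) L j i *+ 2 * f 0 j * a) * (x i ^ a * omono x r f).
Proof.
move=> [ux cx]; rewrite /omono; elim: r => [|j r IH].
  by rewrite !big_nil !mul1r mulr1.
rewrite !big_cons -mulrA IH mulrA -central_exp -[_ * x j ^ _ * _]mulrA [x j ^ _ * _]mulrA.
by rewrite (quasi_comm_exp _ _ _ _ _ (ux j) (ux i) (cx j i)) addrC expD -!mulrA.
Qed.

(** By induction on the list, the head power of the second factor moves left past the tail of the
    first. Sortedness makes the crossed pairs exactly those with [i < j]. *)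
Lemma omono_mul L x r f g : quasi_comm L x ->
  sorted (fun i j : 'I_N => (i < j)%N) r ->
  omono x r f * omono x r g
  = t ^ (\sum_(i <- r) \sum_(j <- r | (i < j)%N) L j i *+ 2 * f 0 j * g 0 i)
    * omono x r (f + g).
Proof.
move=> qx; have [ux _] := qx; elim: r => [|i r IH] ir.
  by rewrite /omono !big_nil !mul1r.
have tr : transitive (fun i j : 'I_N => (i < j)%N) by move=> u v w; apply: ltn_trans.
have rs : sorted (fun i j : 'I_N => (i < j)%N) r by apply: path_sorted ir.
have /allP ri := order_path_min tr ir.
have -> : \sum_(i0 <- i :: r) \sum_(j <- i :: r | (i0 < j)%N) L j i0 *+ 2 * f 0 j * g 0 i0
  = \sum_(j <- r) L j i *+ 2 * f 0 j * g 0 i +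
    \sum_(i0 <- r) \sum_(j <- r | (i0 < j)%N) L j i0 *+ 2 * f 0 j * g 0 i0.
  rewrite big_cons big_cons ltnn; congr (_ + _).
    rewrite big_seq_cond [RHS]big_seq; apply: eq_bigl => j.
    by case jr: (j \in r) => //=; apply: ri.
  rewrite big_seq [RHS]big_seq; apply: eq_bigr => j jr.
  by rewrite big_cons ltnNge ltnW // ri.
have cons f' : omono x (i :: r) f' = x i ^ f' 0 i * omono x r f'.
  by rewrite /omono big_cons.
rewrite !cons -mulrA [omono x r f * _]mulrA (omono_swap L) // -!mulrA IH //.
rewrite mxE (exprzDr (ux i)) expD.
move: (t ^ _) (central_exp (\sum_(j <- r) L j i *+ 2 * f 0 j * g 0 i)) => s1 c1.
set n2 := \sum_(i0 <- r) _; move: (t ^ n2) (central_exp n2) => s2 c2.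
by rewrite !mulrA -c1 -!mulrA; congr (_ * _); rewrite !c2 -!mulrA.
Qed.

Lemma sum_pairs (F : 'I_N -> 'I_N -> int) : (forall i, F i i = 0) ->
  \sum_i \sum_j F i j = \sum_(i < N) \sum_(j < N | (i < j)%N) (F i j + F j i).
Proof.
move=> F0; under [RHS]eq_bigr do rewrite big_split /=.
rewrite big_split /= [X in _ = _ + X](exchange_big_dep predT) //= -big_split /=.
apply: eq_bigr => i _; rewrite (bigID (fun j : 'I_N => (i < j)%N)) /=; congr (_ + _).
rewrite big_mkcond [RHS]big_mkcond /=; apply: eq_bigr => j _.
by case: ltngtP => // /val_inj ->; rewrite F0.
Qed.

Lemma index_enum_sorted : sorted (fun i j : 'I_N => (i < j)%N) (index_enum 'I_N).
Proof.
rewrite [index_enum _]unlock -enumT.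
by have := iota_ltn_sorted 0 N; rewrite -val_enum_ord sorted_map.
Qed.

(** Reordering contributes an exponent over pairs [i < j]. Once [sum_pairs] folds the bilinear form
    onto the same pairs, skew-symmetry makes the exponents agree summand by summand. *)
Lemma frameOf_toric L x : L^T = - L -> quasi_comm L x -> toric L (frameOf t L x).
Proof.
move=> sL qx; have Lij i j : L j i = - L i j.
  by have /matrixP/(_ i j) := sL; rewrite !mxE.
split.
  rewrite /frameOf !big1 ?oppr0 ?mul1r //.
  - by move=> i _; rewrite mxE.
  - by move=> i _; rewrite big1 // => j _; rewrite mxE mulr0 mul0r.
move=> f g; rewrite /frameOf -/(omono x _ f) -/(omono x _ g) -/(omono x _ (f + g)).
rewrite mulrA -[_ * _ * t ^ _]mulrA -central_exp -!mulrA (omono_mul L) //; last first.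
  exact: index_enum_sorted.
rewrite !mulrA -!expD; congr (t ^ _ * _).
rewrite bil_sum sum_pairs; last first.
  by move=> i; have := Lij i i; nia.
rewrite -!sumrN -!big_split /=; apply: eq_bigr => i _.
rewrite -!sumrN -!big_split /=; apply: eq_bigr => j _.
by rewrite !mxE [L j i]Lij mulr2n; ring.
Qed.

Lemma frameOf_evec L x i : L^T = - L -> frameOf t L x (evec i) = x i.
Proof.
move=> sL; rewrite /frameOf big1 ?oppr0 ?mul1r; last first.
  move=> a _; rewrite big1 // => b ab; rewrite !evecE.
  have [ia|ia] := eqVneq i a; last by rewrite mulr0 mul0r.
  by have [ib|ib] := eqVneq i b; rewrite ?mulr0 //; move: ab; rewrite -ia -ib ltnn.
suff /(_ _ (index_enum_uniq _)) -> : forall r : seq 'I_N, uniq r ->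
    \prod_(j <- r) x j ^ (evec i 0 j) = if i \in r then x i else 1.
  by rewrite mem_index_enum.
elim=> [|j r IH] /=; first by rewrite big_nil.
case/andP=> jr ur; rewrite big_cons IH // evecE in_cons.
have [->|ij] /= := eqVneq i j; first by rewrite (negPf jr) mulr1.
by rewrite mul1r.
Qed.

(** A seed stores only the values on the basis; uniqueness of toric maps shows that they recover the
    given frame. *)
Lemma frameOf_base L M f : L^T = - L -> toric L M ->
  frameOf t L (fun i => M (evec i)) f = M f.
Proof.
move=> sL tM; apply: (toric_unique L) => //; last by move=> i; apply: frameOf_evec.
apply: frameOf_toric => //; split=> [i|i j]; first exact: (toric_unit L).
by rewrite (toric_quasi_comm L) // bil_evec.
Qed.
End ToricFrames.

(** * Independence of frame monomials *)

Section Span.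
Context {N : nat} {R : unitRingType}.
Variables (t : R) (C : R -> Prop).
Hypothesis (ut : t \is a GRing.unit).
Hypothesis (sC : Defs.subring_closed C).
Hypotheses (Ct : C t) (CtV : C t^-1).
Implicit Types (f g h : 'rV[int]_N) (Q : 'rV[int]_N -> Prop).
Implicit Types (M : 'rV[int]_N -> R) (n : int) (u v w : R).

Lemma subring_exp n : C (t ^ n).
Proof.
have [C0 C1 CD CN CM] := sC.
have Cn (u : R) (m : nat) : C u -> C (u ^+ m).
  by move=> Cu; elim: m => [|m IH]; rewrite ?expr0 // exprS; apply: CM.
case: (intP n) => [|m|m]; [exact: (Cn t 0%N)|exact: Cn|].
by rewrite -exprz_inv; apply: Cn.
Qed.

(** [C] will be the Laurent polynomials in [t] or the ring [Z[z]]; [Q] restricts the exponents that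
    may occur. *)
Inductive mspan M Q : R -> Prop :=
| mspan0 : mspan M Q 0
| mspanS a g y : C a -> Q g -> mspan M Q y -> mspan M Q (a * M g + y).

Lemma mspan_term M Q a g : C a -> Q g -> mspan M Q (a * M g).
Proof. by move=> Ca Qg; rewrite -[_ * _]addr0; apply: mspanS => //; apply: mspan0. Qed.

Lemma mspanD M Q u v : mspan M Q u -> mspan M Q v -> mspan M Q (u + v).
Proof.
move=> su sv; elim: su => [|a g y Ca Qg _ IH]; first by rewrite add0r.
by rewrite -addrA; apply: mspanS.
Qed.

Lemma mspanZ M Q a u : C a -> mspan M Q u -> mspan M Q (a * u).
Proof.
move=> Ca; have [_ _ _ _ CM] := sC.
elim=> [|b g y Cb Qg _ IH]; first by rewrite mulr0; apply: mspan0.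
by rewrite mulrDr mulrA; apply: mspanS => //; apply: CM.
Qed.

Lemma mspanN M Q u : mspan M Q u -> mspan M Q (- u).
Proof. by have [_ C1 _ CN _] := sC; rewrite -mulN1r; apply/mspanZ/CN. Qed.

Lemma mspan_mono M (Q Q' : 'rV[int]_N -> Prop) u :
  (forall g, Q g -> Q' g) -> mspan M Q u -> mspan M Q' u.
Proof. by move=> QQ; elim=> [|a g y Ca Qg _ IH]; [apply: mspan0|apply: mspanS; auto]. Qed.

Lemma mspan_sum M Q (s : seq 'rV[int]_N) (F : 'rV[int]_N -> R) :
  (forall f, f \in s -> mspan M Q (F f)) -> mspan M Q (\sum_(f <- s) F f).
Proof.
move=> sF; rewrite big_seq; apply: big_ind => [|u v|f fs]; [exact: mspan0|exact: mspanD|exact: sF].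
Qed.

Lemma mspan_mulr (L : 'M[int]_N) M (Q Q' : 'rV[int]_N -> Prop) u h : toric t L M ->
  (forall g, Q g -> Q' (g + h)) -> mspan M Q u -> mspan M Q' (u * M h).
Proof.
move=> [_ MM] QQ; have [_ _ _ _ CM] := sC.
elim=> [|a g y Ca Qg _ IH]; first by rewrite mul0r; apply: mspan0.
rewrite mulrDl -mulrA MM mulrA; apply: mspanS; auto.
by apply: CM => //; apply: subring_exp.
Qed.

(** Repeated exponents are merged, since independence is stated for duplicate-free lists. *)
Lemma mspan_list M Q u : mspan M Q u -> exists (s : seq 'rV[int]_N) (a : 'rV[int]_N -> R),
  [/\ uniq s, forall f, C (a f), forall f, f \in s -> Q f & u = \sum_(f <- s) a f * M f].
Proof.
have [C0 _ CD _ _] := sC.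
elim=> [|c g y Cc Qg _ [s [a [us Ca Qs ->]]]].
  by exists [::], (fun=> 0); split => //; rewrite big_nil.
case gs: (g \in s); last first.
  exists (g :: s), (fun f => if f == g then c else a f); split=> /=.
  - by rewrite gs.
  - by move=> f; case: ifP.
  - by move=> f; rewrite inE => /orP[/eqP->|/Qs].
  - rewrite big_cons eqxx; congr (_ + _); apply: eq_big_seq => f fs.
    by case: eqP => // fg; rewrite -fg fs in gs.
exists s, (fun f => if f == g then c + a g else a f); split=> //.
  by move=> f; case: ifP => // _; apply: CD.
rewrite !(bigD1_seq g) //= eqxx mulrDl addrA; congr (_ + _).
by apply: eq_bigr => f /negPf ->.
Qed.

Definition mfree M : Prop := forall (s : seq 'rV[int]_N) (a : 'rV[int]_N -> R),
  uniq s -> (forall f, C (a f)) -> \sum_(f <- s) a f * M f = 0 ->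
  forall f, f \in s -> a f = 0.

(** Moving [a * M g] across gives a relation in which [g] occurs once, with coefficient [- a]. *)
Lemma mfree_span M Q a g : mfree M -> C a -> ~ Q g -> mspan M Q (a * M g) -> a = 0.
Proof.
move=> fM Ca nQ /mspan_list [s [b [us Cb Qs e]]]; have [_ _ _ CN _] := sC.
have gs : g \notin s by apply/negP => /Qs.
have := fM (g :: s) (fun f => if f == g then - a else b f); rewrite /= gs us.
move=> /(_ isT _ _ g (mem_head _ _)); rewrite eqxx => h.
apply/eqP; rewrite -oppr_eq0; apply/eqP; apply: h.
  by move=> f; case: ifP => // _; apply: CN.
rewrite big_cons eqxx mulNr e; apply/eqP; rewrite addrC subr_eq0; apply/eqP.
apply: eq_big_seq => f fs; case: eqP => // fg; by rewrite -fg fs in gs.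
Qed.

Lemma seq_min (phi : 'rV[int]_N -> int) (s : seq 'rV[int]_N) : s != [::] ->
  exists2 f, f \in s & forall g, g \in s -> phi f <= phi g.
Proof.
elim: s => // f s IH _; case: (eqVneq s [::]) => [->|/IH [g gs gmin]].
  by exists f => [|g]; rewrite inE // => /eqP->.
case: (lerP (phi f) (phi g)) => fg.
  exists f; rewrite ?mem_head // => h; rewrite inE => /orP[/eqP->//|/gmin].
  exact: le_trans.
exists g; first by rewrite inE gs orbT.
by move=> h; rewrite inE => /orP[/eqP->|/gmin //]; apply: ltW.
Qed.

(* Leading-term argument: the phi-minimal M (tau f) cannot cancel. *)
Lemma mfree_triangular M Y (tau : 'rV[int]_N -> 'rV[int]_N) (phi : 'rV[int]_N -> int)
  (s : seq 'rV[int]_N) (a : 'rV[int]_N -> R) :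
  mfree M -> injective tau ->
  (forall f, f \in s -> exists c w, Y f = t ^ c * M (tau f) + w /\
     mspan M (fun g => phi (tau f) < phi g) w) ->
  uniq s -> (forall f, C (a f)) -> \sum_(f <- s) a f * Y f = 0 ->
  forall f, f \in s -> a f = 0.
Proof.
move=> fM tauI; elim: {s}(size s) {-2}s (erefl (size s)) => [|n IH] s.
  by move/eqP/nilP=> -> _ _ _ _ f.
move=> sn hY us Ca s0.
have [f0 f0s f0min] : exists2 f, f \in s & forall g, g \in s -> phi (tau f) <= phi (tau g).
  by apply: (seq_min (fun f => phi (tau f))); case: s sn {hY us s0}.
have [c [w [Yf0 sw]]] := hY _ f0s.
have e : a f0 * t ^ c * M (tau f0) = - (a f0 * w) - \sum_(f <- rem f0 s) a f * Y f.
  move: s0; rewrite (big_rem f0) //= Yf0 mulrDr mulrA => /eqP.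
  by rewrite -addrA addr_eq0 => /eqP->; rewrite opprD.
have urem : uniq (rem f0 s) by apply: rem_uniq.
have remE f : f \in rem f0 s -> f \in s /\ f != f0.
  by rewrite mem_rem_uniq // !inE => /andP[].
have a0 : a f0 = 0.
  have [_ _ _ _ CM] := sC.
  have : a f0 * t ^ c = 0.
    (* Every other exponent differs from [tau f0]: error terms have strictly larger [phi], and the
       other leading exponents differ by injectivity of [tau]. *)
    apply: (mfree_span M (fun g => g <> tau f0) _ (tau f0) fM) => //.
      by apply: CM => //; apply: subring_exp.
    rewrite e; apply: mspanD; apply: mspanN.
      by apply: mspanZ => //; apply: mspan_mono sw => g + ge; rewrite ge ltxx.
    apply: mspan_sum => f /remE [fs ff0]; apply: mspanZ => //.
    have [c' [w' [-> sw']]] := hY _ fs; apply: mspanD.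
      by apply: mspan_term; [exact: subring_exp|move/tauI => e'; rewrite e' eqxx in ff0].
    apply: mspan_mono sw' => g + ge; rewrite ge ltNge; have := f0min _ fs.
    by move=> ->.
  by move/(congr1 (fun u => u * t ^ (- c))); rewrite -mulrA expK // mulr1 mul0r.
move=> f fs; have [->//|ff0] := eqVneq f f0.
apply: (IH (rem f0 s)) => //.
- by rewrite size_rem // sn.
- by move=> g /remE [gs _]; apply: hY.
- by move: s0; rewrite (big_rem f0) //= a0 mul0r add0r.
- by rewrite mem_rem_uniq // !inE ff0.
Qed.
End Span.

(** * Mutation of frames *)

Section MutatedFrame.
Context {N : nat} {R : unitRingType}.
Variables (t : R) (ex : {set 'I_N}) (d : 'I_N -> nat) (s : seed N R) (k : 'I_N).
Hypotheses (ct : central t) (ut : t \is a GRing.unit).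
Hypotheses (kex : k \in ex) (cs : compatible ex d (sL s) (sB s)).
Hypothesis (qs : quasi_comm t (sL s) (sx s)).
Implicit Types (f g h : 'rV[int]_N) (i j : 'I_N).

Local Notation L := (sL s).
Local Notation B := (sB s).
Local Notation b := (bcol B k).
Local Notation x' := (sx (mutS t k s)).
Local Notation L' := (mutL k B L).
Local Notation E := (mutE k B).
Local Notation v := (- evec k - negp b).
Local Notation M := (frameOf t L (sx s)).
Local Notation M' := (frameOf t L' x').

Let sL : L^T = - L. Proof. by case: cs. Qed.
Let sL' : L'^T = - L'. Proof. by case: (mut_compatible ex d L B cs k kex). Qed.
Let tM : toric t L M. Proof. exact: frameOf_toric. Qed.

Lemma mut_var_neq i : i != k -> x' i = sx s i.
Proof. by move=> /negPf /= ->. Qed.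

Lemma mut_var : x' k = M (v + b) + M v.
Proof. by rewrite /= eqxx posp_negp addrA. Qed.

(** The monomials at [v] and [v + b] have the same commutation factor with each [x_j], [j != k],
    because [b] pairs to zero with [evec j]. That factor is the one in [L'], since [v] is the image
    of [evec k] under [E^T]. *)
Lemma mut_quasi_comm : x' k \is a GRing.unit -> quasi_comm t L' x'.
Proof.
move=> ux; have [us cx] := qs; split=> [i|].
  by have [->//|ik] := eqVneq i k; rewrite mut_var_neq.
have L'E i j : L' i j = bil L (evec i *m E^T) (evec j *m E^T).
  by rewrite -bil_mutL bil_evec.
have sMe i : sx s i = M (evec i) by rewrite frameOf_evec.
have kj j : j != k -> x' k * x' j = t ^ (L' k j *+ 2) * (x' j * x' k).
  move=> jk; rewrite mut_var mut_var_neq // L'E (evec_mutE_eq _ _ _ _ cs) //.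
  rewrite evec_mutE_neq // sMe mulrDl !mulrDr.
  rewrite !(toric_quasi_comm t ut L M _ (evec j)) // bilDl (bil_bcol ex d _ _ cs) //.
  by rewrite evecE (negPf jk) mulr0 addr0.
move=> i j; have [->|ik] := eqVneq i k.
  have [->|jk] := eqVneq j k; last exact: kj.
  have -> : L' k k = 0 by rewrite -bil_evec bilff.
  by rewrite mul0rn expr0z mul1r.
have [->|jk] := eqVneq j k; last first.
  by rewrite !mut_var_neq // L'E !evec_mutE_neq // bil_evec.
rewrite kj // mulrA -expD //.
have -> : L' i k = - L' k i by have /matrixP/(_ k i) := sL'; rewrite !mxE.
by rewrite mulNrn addNr mul1r.
Qed.

Lemma frameOf_mut_eq g : g 0 k = 0 -> M' g = M g.
Proof.
move=> gk; rewrite /frameOf; congr (t ^ (- _) * _).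
  apply: eq_bigr => i _; apply: eq_bigr => j _.
  have [->|ik] := eqVneq i k; first by rewrite gk !mulr0 !mul0r.
  have [->|jk] := eqVneq j k; first by rewrite gk !mulr0.
  by rewrite -[L' i j]bil_evec bil_mutL !evec_mutE_neq // bil_evec.
apply: eq_bigr => i _; have [->|ik] := eqVneq i k; first by rewrite gk !expr0z.
by rewrite mut_var_neq.
Qed.

(* No exponent on the right-hand side is negative, so kappa can be applied to it. *)
Lemma mut_exchange : sx s k * x' k
  = t ^ bil L (evec k) (v + b) * M (posp b) + t ^ bil L (evec k) v * M (- negp b).
Proof.
have -> : sx s k = M (evec k) by rewrite frameOf_evec.
rewrite mut_var mulrDr !(tM.2); congr (_ * M _ + _ * M _).
  by rewrite posp_negp !addrA subrr sub0r.
by rewrite addrA subrr sub0r.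
Qed.

Variable (C : R -> Prop).
Hypothesis (sC : Defs.subring_closed C).
Hypotheses (Ct : C t) (CtV : C t^-1).

(** The standard dot product with [b]. Its value at [b] is a sum of squares, nonzero because [b] is,
    so [v + b] ranks strictly above [v]. *)
Let phi g := bil 1%:M b g.

Let phi_b : 0 < phi b.
Proof.
have -> : phi b = \sum_i b 0 i ^+ 2.
  by rewrite /phi /bil mulmx1 mxE; apply: eq_bigr => i _; rewrite [b^T _ _]mxE.
rewrite lt_def sumr_ge0 ?andbT => [|i _]; last exact: sqr_ge0.
rewrite psumr_eq0 => [|i _]; last exact: sqr_ge0.
apply: contra (bcol_neq0 ex d L B cs k kex) => /allP h.
apply/eqP/rowP => i; rewrite [RHS]mxE; apply/eqP.
by rewrite -sqrf_eq0; apply: h; rewrite mem_index_enum.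
Qed.

(** Vanishing would be a relation between the monomials at the distinct exponents [v] and
    [v + b]. *)
Lemma mut_var_neq0 : mfree C M -> x' k != 0.
Proof.
move=> fM; have [C0 C1 CD CN CM] := sC.
apply/eqP; rewrite mut_var => h.
have : (1 : R) = 0; last by move/eqP; rewrite oner_eq0.
apply: (mfree_span C sC M (fun g => g <> v) 1 v fM C1) => //.
move/eqP: h; rewrite addrC addr_eq0 mul1r => /eqP->; rewrite -mulN1r.
apply: mspan_term; first exact: CN.
move=> vb; have /eqP := bcol_neq0 ex d L B cs k kex; apply.
by apply: (addrI v); rewrite vb addr0.
Qed.

(** The powers of the new variable are expanded one factor at a time: the summand [M v] continues
    the leading term, while [M (v + b)] raises [phi]. *)
Lemma mut_frame_leading f (n : nat) : x' k \is a GRing.unit -> f 0 k = 0 ->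
  exists c w, M' (f + evec k *+ n) = t ^ c * M (f + v *+ n) + w /\
    mspan C M (fun g => phi (f + v *+ n) < phi g) w.
Proof.
move=> ux fk; have qs' := mut_quasi_comm ux.
have tM' : toric t L' M' by apply: frameOf_toric.
have CX c : C (t ^ c) by apply: subring_exp.
elim: n => [|n [c [w [e sw]]]].
  exists 0, 0; rewrite !mulr0n !addr0 expr0z mul1r; split; last exact: mspan0.
  exact: frameOf_mut_eq.
rewrite !mulrSr (addrA f (evec k *+ n)) (addrA f (v *+ n)).
set f1 := f + v *+ n in e sw *.
exists (- bil L' (f + evec k *+ n) (evec k) + c + bil L f1 v).
rewrite (toricD t ut L') // frameOf_evec // e.
set c0 := - bil L' _ _.
rewrite mut_var.
exists (t ^ c0 * (t ^ c * M f1 * M (v + b) + w * (M (v + b) + M v))); split.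
  have -> : t ^ (c0 + c + bil L f1 v) * M (f1 + v) = t ^ c0 * (t ^ c * M f1 * M v).
    by rewrite !expD // -[t ^ c * M f1 * M v]mulrA tM.2 !mulrA.
  rewrite -mulrDr; congr (t ^ c0 * _); rewrite mulrDl mulrDr.
  by rewrite [X in X + _]addrC addrA.
apply: mspanZ => //; have [_ MM] := tM; apply: mspanD.
  rewrite -mulrA MM mulrA; apply: mspan_term; first by case: sC => _ _ _ _; apply.
  by rewrite (addrA f1 v b) /phi [in X in _ < X]bilDr ltrDl; apply: phi_b.
rewrite mulrDr; apply: mspanD; apply: (mspan_mulr t C sC Ct CtV L) sw => // g.
  move=> h; rewrite (addrA g v b) /phi (bilDr _ _ _ b) !(bilDr _ _ _ v).
  by apply: ltr_wpDr; [apply: ltW phi_b|rewrite ltrD2r].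
by move=> h; rewrite /phi !(bilDr _ _ _ v) ltrD2r.
Qed.

(** A relation is multiplied by a power of the new variable until all its exponents at [k] are
    nonnegative. The leading exponents are then given by the injective map [f |-> (f + h) E^T], and
    [mfree_triangular] applies. *)
Lemma mut_free : mfree C M -> x' k \is a GRing.unit -> mfree C M'.
Proof.
move=> fM ux r a ur Ca r0.
have tM' : toric t L' M' by apply: frameOf_toric => //; apply: mut_quasi_comm.
have [m mP] : exists m : nat, forall f, f \in r -> 0 <= f 0 k + m%:Z.
  elim: r {ur r0} => [|f r [m mP]]; first by exists 0%N.
  exists (m + absz (f 0%R k))%N => g; rewrite inE => /orP[/eqP->|/mP]; lia.
set h := evec k *+ m.
have enk (n : nat) : (evec k *+ n) 0 k = n%:Z.
  by rewrite -scaler_nat mxE evecE eqxx mulr1 natz.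
apply: (mfree_triangular t C ut sC Ct CtV M (fun f => M' f * M' h)
         (fun f => (f + h) *m E^T) phi r a fM) => //.
- by move=> f g /(mul_mutE_inj _ _ _ _ cs _ kex) /addIr.
- move=> f fr.
  have hk : (f + h) 0 k = (f 0 k + m%:Z) by rewrite mxE enk.
  have [n nE] : exists n : nat, f 0 k + m%:Z = n by exists (absz (f 0 k + m)); have := mP _ fr; lia.
  set g := f + h - evec k *+ n.
  have gk : g 0 k = 0.
    by rewrite [LHS]mxE hk nE [X in _ + X]mxE enk subrr.
  have [c [w [e sw]]] := mut_frame_leading g n ux gk.
  have gE : g + evec k *+ n = f + h by rewrite subrK.
  (* [E^T] fixes [g], whose coordinate [k] vanishes, and sends [evec k] to [v]. *)
  have gvE : g + v *+ n = (f + h) *m E^T.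
    rewrite -[in RHS]gE [RHS]mulmxDl; congr (_ + _).
      by apply/rowP => i; rewrite (mul_mutE _ _ _ _ cs) // gk mul0r subr0.
    by rewrite -[RHS]/(mulmxr _ _) raddfMn /= (evec_mutE_eq _ _ _ _ cs).
  rewrite gE gvE in e sw.
  exists (bil L' f h + c), (t ^ bil L' f h * w); split.
    by rewrite tM'.2 e expD // mulrDr mulrA.
  by apply: mspanZ => //; apply: subring_exp.
- under eq_bigr do rewrite mulrA.
  by rewrite -mulr_suml r0 mul0r.
Qed.
End MutatedFrame.

(** * Evaluation at q^(1/2) and divisibility by cyclotomic polynomials *)

Section Evaluation.
Context {R : unitRingType}.
Variable t : R.
Hypothesis ct : central t.
Implicit Types (p q : {poly int}) (u : R).

Lemma pevalD p q : peval (p + q) t = peval p t + peval q t.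
Proof. by rewrite /peval rmorphD hornerD. Qed.

Lemma peval0 : peval 0 t = 0.
Proof. by rewrite /peval rmorph0 horner0. Qed.

Lemma pevalC (c : int) : peval c%:P t = c%:~R.
Proof. by rewrite /peval map_polyC hornerC. Qed.

Lemma pevalN p : peval (- p) t = - peval p t.
Proof. by rewrite /peval rmorphN hornerN. Qed.

Lemma pevalM p q : peval (p * q) t = peval p t * peval q t.
Proof.
rewrite /peval rmorphM hornerM_comm //; exact: commr_sym (ct _).
Qed.

Lemma peval1 : peval 1 t = 1.
Proof. by rewrite -[1]/(1%:P) pevalC. Qed.

Lemma pevalXn (m : nat) : peval 'X^m t = t ^+ m.
Proof. by rewrite /peval map_polyXn hornerXn. Qed.

Lemma peval_central p u : peval p t * u = u * peval p t.
Proof.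
elim/poly_ind: p => [|p c IH]; first by rewrite peval0 mul0r mulr0.
rewrite pevalD pevalM pevalC -['X]expr1 pevalXn expr1 mulrDl mulrDr; congr (_ + _).
  by rewrite -mulrA ct mulrA IH -mulrA.
by rewrite mulrzl mulrzr.
Qed.

Lemma peval_closed : Defs.subring_closed (fun a => exists p, a = peval p t).
Proof.
split.
- by exists 0; rewrite peval0.
- by exists 1; rewrite peval1.
- by move=> _ _ [p ->] [q ->]; exists (p + q); rewrite pevalD.
- by move=> _ [p ->]; exists (- p); rewrite pevalN.
- by move=> _ _ [p ->] [q ->]; exists (p * q); rewrite pevalM.
Qed.

End Evaluation.

Local Notation pZtoC := (map_poly (intr : int -> algC)).
Local Notation pQtoC := (map_poly (ratr : rat -> algC)).

Lemma peval_Cyclotomic (l : nat) (e : algC) :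
  l.-primitive_root e -> peval (Cyclotomic l) e = 0.
Proof.
move=> el; rewrite /peval -/(pZtoC _) (Cintr_Cyclotomic el) -(minCpoly_cyclotomic el).
exact/eqP/root_minCpoly.
Qed.

(** The cyclotomic polynomial is monic, so division stays over the integers. The remainder vanishes
    at [e] and has degree below that of the minimal polynomial, hence is zero. *)
Lemma Cyclotomic_dvd (l : nat) (e : algC) (p : {poly int}) :
  l.-primitive_root e -> peval p e = 0 -> exists q, p = Cyclotomic l * q.
Proof.
move=> el p0; have ce : central e by move=> u; apply: mulrC.
have mon : Cyclotomic l \is monic by apply: Cyclotomic_monic.
have sz := Pdiv.Ring.ltn_rmodp p (Cyclotomic l).
have := Pdiv.RingMonic.rdivp_eq mon p.
move: sz; set r := Pdiv.Ring.rmodp _ _; set q := Pdiv.Ring.rdivp _ _.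
rewrite monic_neq0 // => sz pE; exists q.
suff r0 : r = 0 by rewrite {1}pE r0 addr0 mulrC.
have eP : pZtoC (Cyclotomic l) = minCpoly e.
  by rewrite (Cintr_Cyclotomic el) (minCpoly_cyclotomic el).
have re : root (pQtoC (map_poly intr r)) e.
  have -> : pQtoC (map_poly intr r) = pZtoC r.
    by rewrite -map_poly_comp; apply: eq_map_poly => c /=; rewrite ratr_int.
  rewrite /root; apply/eqP; move: p0; rewrite pE pevalD pevalM //.
  by rewrite (peval_Cyclotomic l) // mulr0 add0r.
have [m [mE _ mdvd]] := minCpolyP e.
rewrite mdvd in re.
apply/eqP; apply: contraTT re => r0; apply/negP => /dvdp_leq.
rewrite map_poly_eq0_id0 ?intr_eq0 ?lead_coef_eq0 // => /(_ r0).
rewrite leqNgt => /negP; apply.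
have -> : size m = size (Cyclotomic l).
  by rewrite -(size_map_poly (ratr : rat -> algC)) -mE -eP size_map_inj_poly //; apply: intr_inj.
by rewrite (size_map_inj_poly (@intr_inj _)).
Qed.

Section SubringClosed.
Context {R : unitRingType}.
Implicit Types (S P : R -> Prop).

Lemma gen_subring_closed S : Defs.subring_closed (gen_subring S).
Proof.
split=> [P [] //|P [] //|a b Sa Sb P cP SP|a Sa P cP SP|a b Sa Sb P cP SP];
  have [_ _ PD PN PM] := cP.
- by apply: PD; [apply: Sa|apply: Sb].
- by apply: PN; apply: Sa.
- by apply: PM; [apply: Sa|apply: Sb].
Qed.

Lemma gen_subring_mem S a : S a -> gen_subring S a.
Proof. by move=> Sa P _; apply. Qed.

End SubringClosed.

(** * Laurent polynomials in q^(1/2) *)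

Section LaurentCoefficients.
Context {R : unitRingType}.
Variable t : R.
Hypotheses (ct : central t) (ut : t \is a GRing.unit).

(** Membership in [Z[t, t^-1]] by clearing a power of [t], which leaves an integer polynomial to
    which cyclotomic divisibility applies. *)
Definition laurent (a : R) : Prop := exists (m : nat) p, t ^+ m * a = peval p t.

Lemma laurent_closed : Defs.subring_closed laurent.
Proof.
have cX (m : nat) u : t ^+ m * u = u * t ^+ m by rewrite -pevalXn peval_central.
split.
- by exists 0%N, 0; rewrite mulr0 peval0.
- by exists 0%N, 1; rewrite mulr1 peval1.
- move=> a b [m [p ea]] [n [q eb]]; exists (m + n)%N, ('X^n * p + 'X^m * q).
  rewrite pevalD !pevalM // !pevalXn -ea -eb mulrDr !mulrA -!exprD.
  by rewrite [(n + m)%N]addnC.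
- by move=> a [m [p ea]]; exists m, (- p); rewrite pevalN mulrN ea.
- move=> a b [m [p ea]] [n [q eb]]; exists (m + n)%N, (p * q).
  by rewrite pevalM // -ea -eb exprD -!mulrA; congr (_ * _); rewrite !mulrA cX.
Qed.

Lemma laurent_t : laurent t.
Proof. by exists 0%N, 'X; rewrite mul1r -['X]expr1 pevalXn. Qed.

Lemma laurent_tV : laurent t^-1.
Proof. by exists 1%N, 1; rewrite expr1 divrr // peval1. Qed.

Lemma laurent_central a u : laurent a -> a * u = u * a.
Proof.
move=> [m [p ea]]; have utm : t ^+ m \is a GRing.unit by exact: unitrX.
apply: (mulrI utm); rewrite mulrA ea peval_central // -ea mulrA.
by rewrite -pevalXn -peval_central // -mulrA.
Qed.

Lemma laurent_sub (S : R -> Prop) a : Defs.subring_closed S -> S t -> S t^-1 ->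
  laurent a -> S a.
Proof.
move=> cS St StV [m [p ea]]; have [S0 S1 SD SN SM] := cS.
have utm : t ^+ m \is a GRing.unit by exact: unitrX.
have -> : a = t ^ (- m%:Z) * peval p t by rewrite -ea mulrA -exprnN mulVr // mul1r.
apply: (SM); first exact: subring_exp.
elim/poly_ind: p {ea} => [|p c IH]; first by rewrite peval0.
rewrite pevalD pevalM // pevalC -['X]expr1 pevalXn expr1; apply: (SD); first exact: SM.
have Sn (n : nat) : S (n%:R).
  by elim: n => // n Sn; rewrite -addn1 natrD; apply: SD.
by case: (intP c) => [|n|n]; rewrite ?mulrNz; [exact: (Sn 0%N)|exact: Sn|apply/SN/Sn].
Qed.

End LaurentCoefficients.

(** * Laurent expansions *)

Section ConeExpansion.
Context {N : nat} {R : unitRingType}.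
Variables (t : R) (ex inv : {set 'I_N}) (s : seed N R).
Hypotheses (ct : central t) (ut : t \is a GRing.unit).
Hypotheses (skew : (sL s)^T = - sL s) (qs : quasi_comm t (sL s) (sx s)).

Local Notation M := (frameOf t (sL s) (sx s)).

(** Exponents of the monomials of [Tge]: negative entries only at invertible variables. *)
Definition cone (f : 'rV[int]_N) : Prop := forall i, i \notin ex :|: inv -> 0 <= f 0 i.

Let tM : toric t (sL s) M. Proof. exact: frameOf_toric. Qed.

Lemma Tge_closed : Defs.subring_closed (Tge t ex inv s).
Proof. exact: gen_subring_closed. Qed.

Lemma Tge_t : Tge t ex inv s t.
Proof. by apply: gen_subring_mem; constructor 1. Qed.

Lemma Tge_tV : Tge t ex inv s t^-1.
Proof. by apply: gen_subring_mem; constructor 2. Qed.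

Lemma Tge_frame f : cone f -> Tge t ex inv s (M f).
Proof.
move=> cf; have cT := Tge_closed; have [T0 T1 TD TN TM] := cT.
apply: (TM); first by apply: subring_exp => //; [exact: Tge_t|exact: Tge_tV].
apply: (big_ind (Tge t ex inv s)) => // i _.
have Tx : Tge t ex inv s (sx s i) by apply: gen_subring_mem; constructor 3; exists i.
have TX (u : R) (n : nat) : Tge t ex inv s u -> Tge t ex inv s (u ^+ n).
  by move=> Tu; elim: n => [|n IH]; rewrite ?expr0 // exprS; apply: TM.
case: (boolP (i \in ex :|: inv)) => ii.
  apply: subring_exp => //; apply: gen_subring_mem; constructor 4; by exists i.
by move: (cf _ ii); case: (f 0 i) => // n _; apply: TX.
Qed.

(** The span of cone monomials is a subring, because the cone is closed under addition and the
    coefficients are central, and it contains the generators. *)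
Lemma Tge_span y : Tge t ex inv s y -> mspan (laurent t) M cone y.
Proof.
have cL := laurent_closed t ct; have [L0 L1 LD LN LM] := cL.
have Lt := laurent_t t; have LtV := laurent_tV t ut.
have [M0 MM] := tM; have c0 : cone 0 by move=> i _; rewrite mxE.
have cD f g : cone f -> cone g -> cone (f + g).
  by move=> cf cg i ii; rewrite mxE addr_ge0 ?cf ?cg.
apply; first split.
- exact: mspan0.
- by rewrite -M0 -[M 0]mul1r; apply: mspan_term.
- by move=> a b; apply: mspanD.
- by move=> a; apply: mspanN.
- move=> a b sa; elim=> [|c g z Lc cg _ IH]; first by rewrite mulr0; apply: mspan0.
  rewrite mulrDr; apply: mspanD IH.
  rewrite mulrA -(laurent_central t ct ut c) // -mulrA; apply: mspanZ => //.
  by apply: (mspan_mulr t _ _ _ _ (sL s)) sa => // h ch; apply: cD.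
have ce i : cone (evec i) by move=> j _; rewrite evecE.
have xE i : sx s i = M (evec i) by rewrite frameOf_evec.
move=> a [->|->|[i ->]|[j [ji ->]]].
- by rewrite -[X in mspan _ _ _ X]mulr1 -M0; apply: mspan_term.
- by rewrite -[X in mspan _ _ _ X]mulr1 -M0; apply: mspan_term.
- by rewrite xE -[M _]mul1r; apply: mspan_term.
- rewrite xE (toric_inv t (sL s)) // -[M _]mul1r; apply: mspan_term => //.
  move=> i ii; rewrite mxE evecE; case: eqP => // ij; by rewrite -ij ji in ii.
Qed.

End ConeExpansion.

(** * Specialization *)

Section RootOfUnityFrame.
Context {N : nat} {R : unitRingType}.
Variables (l : nat) (z : R) (e : algC) (L : 'M[int]_N) (M : 'rV[int]_N -> R).
Hypotheses (l0 : (0 < l)%N) (el : l.-primitive_root e).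
Hypotheses (cz : central z) (ez : forall p : {poly int}, peval p e = 0 -> peval p z = 0).
Hypothesis fM : is_eframe z e L M.

Definition zpoly (a : R) : Prop := exists p, a = peval p z.

Lemma root_expl : z ^+ l = 1.
Proof.
apply/eqP; rewrite -subr_eq0 -(pevalXn z) -(peval1 z) -pevalN -pevalD; apply/eqP/ez.
have ce : central e by move=> u; apply: mulrC.
by rewrite pevalD pevalN peval1 pevalXn (prim_expr_order el) subrr.
Qed.

Lemma root_unit : z \is a GRing.unit.
Proof. by rewrite -(unitrX_pos _ l0) root_expl unitr1. Qed.

Lemma zpoly_closed : Defs.subring_closed zpoly.
Proof. exact: peval_closed. Qed.

Lemma zpoly_z : zpoly z.
Proof. by exists 'X; rewrite -['X]expr1 pevalXn. Qed.

(** The inverse is [z^(l-1)], so [Z[z]] already contains all integer powers of [z]. *)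
Lemma zpoly_zV : zpoly z^-1.
Proof.
exists 'X^(l.-1); rewrite pevalXn; apply: (mulrI root_unit).
by rewrite divrr ?root_unit // -exprS prednK // root_expl.
Qed.

(** Converse of [ez], from independence of the single monomial [M 0 = 1]; together they identify
    [Z[z]] with [Z[e]]. *)
Lemma eframe_peval0 (p : {poly int}) : peval p z = 0 -> peval p e = 0.
Proof.
move=> pz; have [M0 _ ind _] := fM.
apply: (ind [:: 0] (fun=> p) _ _ 0) => //; last by rewrite mem_head.
by rewrite big_seq1 pz mul0r.
Qed.

Lemma eframe_toric : toric z L M.
Proof. by case: fM. Qed.

Lemma eframe_free : mfree zpoly M.
Proof.
move=> s a us Ca s0 f fs; have [_ _ ind _] := fM.
(* The frame axiom speaks of polynomials, so one representing each coefficient is chosen. *)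
have Ca' g : exists p, a g == peval p z by have [p ->] := Ca g; exists p.
rewrite (eqP (xchooseP (Ca' f))); apply: ez.
apply: (ind s (fun g => xchoose (Ca' g)) us _ f fs).
by rewrite -[RHS]s0; apply: eq_bigr => g _; rewrite -(eqP (xchooseP (Ca' g))).
Qed.

End RootOfUnityFrame.

(** * Comparing the quantum and root of unity cluster algebras *)

Section Specialization.
Context {N : nat}.
Variables (l : nat) (ex inv : {set 'I_N}) (L B : 'M[int]_N) (d : 'I_N -> nat).
Variables (Fq : unitRingType) (t : Fq) (Mq : 'rV[int]_N -> Fq).
Variables (Fe : unitRingType) (z : Fe) (e : algC) (M : 'rV[int]_N -> Fe).
Variable kappa : Fq -> Fe.
Hypotheses (l0 : (0 < l)%N) (el : l.-primitive_root e) (LB : compatible ex d L B).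
Hypotheses (Fq_div : is_division_ring Fq) (ct : central t) (fMq : is_qframe t L Mq).
Hypotheses (Fe_div : is_division_ring Fe) (cz : central z).
Hypothesis ez : forall p : {poly int}, peval p e = 0 -> peval p z = 0.
Hypothesis fM : is_eframe z e L M.

Local Notation sq := (Seed (fun i => Mq (evec i)) L B).
Local Notation se := (Seed (fun i => M (evec i)) L B).
Local Notation A := (clusterAlg t ex inv sq).

Hypothesis kappa_hom : forall x y, Tge t ex inv sq x -> Tge t ex inv sq y ->
  kappa (x + y) = kappa x + kappa y /\ kappa (x * y) = kappa x * kappa y.
Hypotheses (kappa1 : kappa 1 = 1) (kappat : kappa t = z) (kappatV : kappa t^-1 = z^-1).
Hypothesis kappa_var : forall i, kappa (Mq (evec i)) = M (evec i).
Hypothesis kappa_varV :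
  forall j, j \in ex :|: inv -> kappa (Mq (evec j))^-1 = (M (evec j))^-1.
Hypothesis AU : forall y, A y <-> upperAlg t ex inv sq y.

Let uz : z \is a GRing.unit. Proof. exact: (root_unit l z e). Qed.
Let skew : L^T = - L. Proof. by case: LB. Qed.
Let tMq : toric t L Mq. Proof. by case: fMq. Qed.
Let tM : toric z L M. Proof. exact: (eframe_toric z e L M). Qed.

Lemma qframe_peval_neq0 (p : {poly int}) : p != 0 -> peval p t != 0.
Proof.
move=> p0; have [M0 _ ind _] := fMq; apply: contra p0 => /eqP pt; apply/eqP.
apply: (ind [:: 0] (fun=> p) _ _ 0) => //; last by rewrite mem_head.
by rewrite big_seq1 pt mul0r.
Qed.

Let ut : t \is a GRing.unit.
Proof.
apply: Fq_div; rewrite -[t]expr1 -(pevalXn t); apply: qframe_peval_neq0.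
by rewrite expr1 polyX_eq0.
Qed.

(** The empty mutation sequence in the definition of [U_q]. This places [A_q] inside the domain on
    which [kappa] is a homomorphism. *)
Let A_Tge y : A y -> Tge t ex inv sq y.
Proof. by move/AU; apply; exists [::]. Qed.

Let A_closed : Defs.subring_closed A. Proof. exact: gen_subring_closed. Qed.

(** [kappa] is assumed to respect sums and products only on [Tge], so membership travels with the
    value. *)
Definition specializes u v : Prop := A u /\ kappa u = v.

Lemma specializesD u v u' v' :
  specializes u v -> specializes u' v' -> specializes (u + u') (v + v').
Proof.
move=> [Au <-] [Au' <-]; have [_ _ AD _ _] := A_closed; split; first exact: AD.
by apply: (kappa_hom _ _ _ _).1; apply: A_Tge.
Qed.

Lemma specializesM u v u' v' :
  specializes u v -> specializes u' v' -> specializes (u * u') (v * v').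
Proof.
move=> [Au <-] [Au' <-]; have [_ _ _ _ AM] := A_closed; split; first exact: AM.
by apply: (kappa_hom _ _ _ _).2; apply: A_Tge.
Qed.

Lemma specializes0 : specializes 0 0.
Proof.
have [A0 _ _ _ _] := A_closed; split=> //.
have := (kappa_hom _ _ (A_Tge _ A0) (A_Tge _ A0)).1; rewrite addr0 => /eqP.
by rewrite -subr_eq0 opprD addrA subrr sub0r oppr_eq0 => /eqP.
Qed.

Lemma specializes1 : specializes 1 1.
Proof. by have [_ A1 _ _ _] := A_closed. Qed.

Lemma specializesN u v : specializes u v -> specializes (- u) (- v).
Proof.
move=> [Au <-]; have [_ _ _ AN _] := A_closed; have ANu := AN _ Au; split=> //.
have := (specializesD _ _ _ _ (conj Au erefl) (conj ANu erefl)).2.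
by rewrite subrr specializes0.2 => /esym/eqP; rewrite addrC addr_eq0 => /eqP.
Qed.

Lemma specializesX u v (n : nat) : specializes u v -> specializes (u ^+ n) (v ^+ n).
Proof.
move=> uv; elim: n => [|n IH]; first exact: specializes1.
by rewrite !exprS; apply: specializesM.
Qed.

Lemma specializes_t : specializes t z.
Proof. by split=> //; apply: gen_subring_mem; constructor 1. Qed.

Lemma specializes_exp (n : int) : specializes (t ^ n) (z ^ n).
Proof.
case: (intP n) => [|m|m]; [exact: specializes1|exact: specializesX specializes_t|].
rewrite -!exprz_inv; apply: specializesX.
by split=> //; apply: gen_subring_mem; constructor 2.
Qed.

Lemma specializes_peval p : specializes (peval p t) (peval p z).
Proof.
elim/poly_ind: p => [|p c IH]; first by rewrite !peval0; apply: specializes0.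
rewrite !pevalD !pevalM // !pevalC -['X]expr1 !pevalXn; apply: specializesD.
  by apply: specializesM => //; apply: specializesX specializes_t.
have Sn (n : nat) : specializes n%:R n%:R.
  elim: n => [|n IHn]; first exact: specializes0.
  by rewrite -addn1 !natrD; apply: specializesD specializes1.
by case: (intP c) => [|n|n]; rewrite ?mulrNz; [exact: (Sn 0%N)|exact: Sn|apply/specializesN/Sn].
Qed.

Lemma specializes_laurent a : laurent t a -> specializes a (kappa a).
Proof.
move=> La; split=> //; apply: (laurent_sub t ct ut) La => //.
  exact: specializes_t.1.
by rewrite -exprN1; apply: (specializes_exp (- 1)).1.
Qed.

(** Specialized coefficients land in [Z[z]], the ring over which the root of unity frames are known
    to be free. *)
Lemma zpoly_kappa a : laurent t a -> zpoly z (kappa a).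
Proof.
move=> La; have [_ ka] := specializes_laurent a La; have [m [p ea]] := La.
have e1 : z ^+ m * kappa a = peval p z.
  rewrite -(specializes_peval p).2 -ea.
  have tm := specializesX _ _ m specializes_t.
  exact: esym (specializesM _ _ _ _ tm (specializes_laurent _ La)).2.
have um : z ^+ m \is a GRing.unit by exact: unitrX.
have -> : kappa a = z ^ (- m%:Z) * peval p z by rewrite -e1 mulrA -exprnN mulVr // mul1r.
have cC := zpoly_closed z cz; have [_ _ _ _ CM] := cC; apply: CM; last by exists p.
by apply: subring_exp => //; [exact: zpoly_z|exact: (zpoly_zV l z e)].
Qed.

Local Notation Phi := (peval (Cyclotomic l) t).

Lemma Phi_unit : Phi \is a GRing.unit.
Proof. by apply/Fq_div/qframe_peval_neq0/monic_neq0/Cyclotomic_monic. Qed.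

(** After clearing [t^m], the polynomial numerator vanishes at [z], hence at [e], hence is a
    multiple of the cyclotomic polynomial. *)
Lemma laurent_Phi_div a : laurent t a -> kappa a = 0 -> laurent t (Phi^-1 * a).
Proof.
move=> La ka; have [m [p ea]] := La.
have pz : peval p z = 0.
  rewrite -(specializes_peval p).2 -ea.
  have tm := specializesX _ _ m specializes_t.
  by rewrite (specializesM _ _ _ _ tm (specializes_laurent _ La)).2 ka mulr0.
have [q pq] := Cyclotomic_dvd l e p el (eframe_peval0 z e L M fM p pz).
exists m, q; apply: (mulrI Phi_unit).
by rewrite -pevalM // -pq -ea mulrA peval_central // -!mulrA mulVKr ?Phi_unit.
Qed.

Lemma specializes_frame (s : seed N Fq) (s' : seed N Fe) (f : 'rV[int]_N) :
  sL s = sL s' -> (forall i, specializes (sx s i) (sx s' i)) ->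
  (forall i, 0 <= f 0 i) ->
  specializes (frameOf t (sL s) (sx s) f) (frameOf z (sL s') (sx s') f).
Proof.
move=> eL hx f0; rewrite /frameOf eL; apply: specializesM; first exact: specializes_exp.
apply: (big_ind2 specializes) => [|u v u' v'|i _]; [exact: specializes1|exact: specializesM|].
by move: (f0 i); case: (f 0 i) => // n _; apply: specializesX.
Qed.

Definition mutated ks : seed N Fq * seed N Fe :=
  (foldl (fun s k => mutS t k s) sq ks, foldl (fun s k => mutS z k s) se ks).

(** The claims are proved in one induction because each feeds the next: freeness makes the new root
    of unity variable invertible, the exchange relation identifies it as a [kappa] image, and so the
    new quantum variable is nonzero. *)
Lemma mutated_spec ks : all (fun k => k \in ex) ks ->
  let s := (mutated ks).1 in let s' := (mutated ks).2 in
  [/\ sL s = sL s', sB s = sB s', compatible ex d (sL s) (sB s),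
      quasi_comm t (sL s) (sx s) &
      [/\ quasi_comm z (sL s') (sx s'),
          mfree (zpoly z) (frameOf z (sL s') (sx s')) &
          forall i, specializes (sx s i) (sx s' i)]].
Proof.
have Avar ks' i : all (fun k => k \in ex) ks' -> A (sx (mutated ks').1 i).
  move=> aks; apply: gen_subring_mem; constructor 3; exists (mutated ks').1, i.
  by split=> //; exists ks'.
elim/last_ind: ks => [_|ks k IH].
  split=> //=.
    split=> [i|i j]; first exact: (toric_unit t L).
    by rewrite (toric_quasi_comm t ut L) // bil_evec.
  split.
  - split=> [i|i j]; first exact: (toric_unit z L).
    by rewrite (toric_quasi_comm z uz L) // bil_evec.
  - move=> s a us Ca s0; apply: (eframe_free z e L M ez fM _ _ us Ca).
    by rewrite -[RHS]s0; apply: eq_bigr => f _; rewrite frameOf_base.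
  - by move=> i; split=> //; apply: (Avar [::]).
rewrite all_rcons => /andP[kex aks].
have Avar' := Avar (rcons ks k) k.
have [eL eB cs qs [qs' fs hx]] := IH aks.
move: Avar'; rewrite /mutated !foldl_rcons /= all_rcons kex => /(_ aks).
set s := foldl _ _ _ in eL eB cs qs hx *; set s' := foldl _ _ _ in eL eB qs' fs hx * => Ak.
have cs' : compatible ex d (sL s') (sB s') by rewrite -eL -eB.
have C := zpoly_closed z cz; have Cz := zpoly_z z; have CzV := zpoly_zV l z e l0 el ez.
have u' : sx (mutS z k s') k \is a GRing.unit.
  by apply: Fe_div; apply: (mut_var_neq0 z ex d s' k kex cs' (zpoly z) C fs).
(* Multiplying by the old variable turns both sides into exchange relations, whose monomials
   specialize termwise. *)
have kk : kappa (sx (mutS t k s) k) = sx (mutS z k s') k.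
  apply: (mulrI (qs'.1 k)).
  rewrite (mut_exchange z ex d s' k cz uz cs' qs').
  rewrite -(hx k).2 -(kappa_hom _ _ (A_Tge _ (hx k).1) (A_Tge _ Ak)).2.
  rewrite (mut_exchange t ex d s k ct ut cs qs) -eB.
  apply: (specializesD _ _ _ _ _ _).2; apply: specializesM;
    try (rewrite eL; exact: specializes_exp); apply: specializes_frame => // i.
  - by rewrite mxE le_max lexx orbT.
  - by rewrite mxE mxE oppr_ge0 ge_min lexx orbT.
have u : sx (mutS t k s) k \is a GRing.unit.
  apply: Fq_div; apply/eqP => x0; move: u'; rewrite -kk x0 specializes0.2.
  by rewrite unitr0.
split=> /=; [by rewrite eL eB|by rewrite eB|exact: mut_compatible| |split].
- exact: (mut_quasi_comm t ex d).
- exact: (mut_quasi_comm z ex d).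
- exact: (mut_free z ex d).
- move=> i; case: (eqVneq i k) => _; last exact: hx.
  by move: Ak kk; rewrite /= !eqxx.
Qed.

Lemma kappa_clusterAlg x : A x -> clusterAlg z ex inv se (kappa x).
Proof.
have cE : Defs.subring_closed (clusterAlg z ex inv se) by apply: gen_subring_closed.
have [E0 E1 ED EN EM] := cE.
(* Membership in [A] is kept in the induction predicate so that [kappa] remains additive and
   multiplicative along it. *)
move=> Ax; apply: (Ax (fun u => A u /\ clusterAlg z ex inv se (kappa u)) _ _).2; first split.
- by split; [case: A_closed|rewrite specializes0.2].
- by split; [case: A_closed|rewrite specializes1.2].
- move=> a b [Aa Ea] [Ab Eb].
  have [Aab ->] := specializesD _ _ _ _ (conj Aa erefl) (conj Ab erefl).
  by split=> //; apply: ED.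
- move=> a [Aa Ea]; have [Ana ->] := specializesN _ _ (conj Aa erefl).
  by split=> //; apply: EN.
- move=> a b [Aa Ea] [Ab Eb].
  have [Aab ->] := specializesM _ _ _ _ (conj Aa erefl) (conj Ab erefl).
  by split=> //; apply: EM.
move=> a Sa; split; first exact: gen_subring_mem.
case: Sa => [->|->|[s [i [[ks [aks ->]] ->]]]|[j [jinv ->]]]; apply: gen_subring_mem.
- by rewrite kappat; constructor 1.
- by rewrite kappatV; constructor 2.
- constructor 3; exists (mutated ks).2, i; split; first by exists ks.
  by have [_ _ _ _ [_ _ hx]] := mutated_spec _ aks; rewrite (hx i).2.
- constructor 4; exists j; split=> //=; apply: kappa_varV.
  by rewrite inE jinv orbT.
Qed.

Lemma kappa_clusterAlg_surj y : clusterAlg z ex inv se y -> exists2 x, A x & kappa x = y.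
Proof.
move=> Ey; suff [x [Ax kx]] : exists x, specializes x y by exists x.
apply: (Ey (fun v => exists x, specializes x v)); first split.
- by exists 0; apply: specializes0.
- by exists 1; apply: specializes1.
- by move=> a b [x xa] [w wb]; exists (x + w); apply: specializesD.
- by move=> a [x xa]; exists (- x); apply: specializesN.
- by move=> a b [x xa] [w wb]; exists (x * w); apply: specializesM.
move=> a [->|->|[s [i [[ks [aks ->]] ->]]]|[j [jinv ->]]].
- by exists t; apply: specializes_t.
- by exists (t ^ (-1)); rewrite -(exprN1 z); apply: specializes_exp.
- by have [_ _ _ _ [_ _ hx]] := mutated_spec _ aks; exists (sx (mutated ks).1 i).
- exists (Mq (evec j))^-1; split; first by apply: gen_subring_mem; constructor 4; exists j.
  by apply: kappa_varV; rewrite inE jinv orbT.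
Qed.

Lemma Phi_specializes : specializes Phi 0.
Proof.
by rewrite -(ez _ (peval_Cyclotomic l e el)); apply: specializes_peval.
Qed.

(* Multiplying x by a cluster monomial clears denominators; kappa of the result is an
   expansion of 0 in the mutated root of unity frame, whose freeness forces
   Phi to divide every coefficient of x. *)
Lemma Tge_Phi_div ks x : all (fun k => k \in ex) ks -> A x -> kappa x = 0 ->
  Tge t ex inv (mutated ks).1 (Phi^-1 * x).
Proof.
move=> aks Ax kx; have [eL eB cs qs [qs' fs hx]] := mutated_spec _ aks.
set s := (mutated ks).1 in eL eB cs qs hx *; set s' := (mutated ks).2 in eL eB qs' fs hx.
have sks : (sL s)^T = - sL s by case: cs.
have tMs : toric t (sL s) (frameOf t (sL s) (sx s)) by apply: frameOf_toric.
have tMs' : toric z (sL s') (frameOf z (sL s') (sx s')).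
  by apply: frameOf_toric => //; rewrite -eL.
have Tx : Tge t ex inv s x by move/AU: Ax; apply; exists ks.
have [r [a [ur La cr xE]]] :=
  mspan_list _ (laurent_closed t ct) _ _ _ (Tge_span t ex inv s ct ut sks qs x Tx).
(* [specializes_frame] covers only nonnegative exponents; adding [|f_i|] for each [f] in the finite
   support yields a suitable shift [g]. *)
have [g [g0 rg0]] : exists g : 'rV[int]_N, (forall i, 0 <= g 0 i) /\
    forall f, f \in r -> forall i, 0 <= (f + g) 0 i.
  elim: (r) => [|f r' [g [g0 gr']]]; first by exists 0; split=> // i; rewrite mxE.
  exists (g + \row_i `|f 0 i|); split=> [i|f' + i].
    by rewrite !mxE addr_ge0.
  rewrite inE => /orP[/eqP->|/gr' /(_ i)]; rewrite !mxE; last by move=> h; rewrite addrA addr_ge0.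
  by rewrite addrCA addr_ge0 // -lerBlDl sub0r -normrN ler_norm.
have xg0 : specializes (x * frameOf t (sL s) (sx s) g) 0.
  rewrite -[0](mul0r (frameOf z (sL s') (sx s') g)); apply: specializesM => //.
  exact: specializes_frame.
(* [kappa] of the shifted element is computed a second time, now term by term from the expansion of
   [x]. *)
have xgE : specializes (x * frameOf t (sL s) (sx s) g)
    ((\sum_(f <- r) kappa (a f) * frameOf z (sL s') (sx s') f) * frameOf z (sL s') (sx s') g).
  rewrite xE !mulr_suml big_seq [X in specializes _ X]big_seq.
  apply: (big_ind2 specializes) => [|u v u' v'|f fr]; [exact: specializes0|exact: specializesD|].
  rewrite -[a f * _ * _]mulrA tMs.2 -[kappa (a f) * _ * _]mulrA tMs'.2.
  apply: specializesM; first exact: specializes_laurent.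
  apply: specializesM; first by rewrite eL; apply: specializes_exp.
  by apply: specializes_frame => //; apply: rg0.
(* The two values agree, and the root of unity monomial at [g] is invertible, so the shift
   cancels. *)
have s0 : \sum_(f <- r) kappa (a f) * frameOf z (sL s') (sx s') f = 0.
  have ug : frameOf z (sL s') (sx s') g \is a GRing.unit.
    by apply: (toric_unit z (sL s')) => //; rewrite -eL.
  by apply: (mulIr ug); rewrite mul0r -xgE.2 xg0.2.
have ka0 := fs _ _ ur (fun f => zpoly_kappa _ (La f)) s0.
have cT := Tge_closed t ex inv s; have [T0 T1 TD TN TM] := cT.
rewrite xE mulr_sumr big_seq; apply: (big_ind (Tge t ex inv s)) => // f fr.
rewrite mulrA; apply: TM; last by apply: Tge_frame => //; apply: cr.
have := laurent_Phi_div _ (La f) (ka0 f fr); apply: (laurent_sub t ct ut) => //.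
  exact: Tge_t.
exact: Tge_tV.
Qed.

Lemma kappa_kernel x : A x ->
  (kappa x = 0 <-> exists2 y, A y & x = Phi * y).
Proof.
move=> Ax; split=> [kx|[y Ay ->]].
  exists (Phi^-1 * x); last by rewrite mulVKr ?Phi_unit.
  by apply/AU => s [ks [aks ->]]; apply: Tge_Phi_div.
by have [_ ->] := specializesM _ _ _ _ Phi_specializes (conj Ay erefl); rewrite mul0r.
Qed.

End Specialization.

(** Surjectivity and the kernel yield the quotient isomorphism by the first isomorphism theorem. As
    it is induced by [kappa], the specialization map becomes the restriction of [kappa]. *)
Theorem theorem5p11 (N l : nat) (ex inv : {set 'I_N}) (L B : 'M[int]_N)
  (d : 'I_N -> nat)
  (Fq : unitRingType) (t : Fq) (Mq : 'rV[int]_N -> Fq)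
  (Fe : unitRingType) (z : Fe) (e : algC) (M : 'rV[int]_N -> Fe)
  (kappa : Fq -> Fe) :
  (* root of unity: e = eps^{1/2} primitive l-th root of unity, z its image *)
  (0 < l)%N -> l.-primitive_root e ->
  (* Lambda skew-symmetric integer; (Lambda, B~) compatible w.r.t. D *)
  L^T = - L ->
  (forall j, j \in ex -> (0 < d j)%N) ->
  (forall i j, i \in ex -> j \in ex -> (d i)%:Z * B i j = - ((d j)%:Z * B j i)) ->
  (forall i j, j \in ex -> \sum_(k < N) B k j * L k i = (i == j)%:Z * (d j)%:Z) ->
  [disjoint inv & ex] ->
  (* quantum side: M_q toric frame with matrix Lambda of a division algebra *)
  is_division_ring Fq -> central t -> is_qframe t L Mq ->
  (* root of unity side: strict root of unity toric frame M (Lambda_M = Lambda mod l) *)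
  is_division_ring Fe -> central z ->
  (forall p : {poly int}, peval p e = 0 -> peval p z = 0) ->
  is_eframe z e L M ->
  (* kappa_eps : T_q(M_q)_>= -> T_eps(M)_>= *)
  let sq := Seed (fun i => Mq (evec i)) L B in
  let se := Seed (fun i => M (evec i)) L B in
  (forall x y, Tge t ex inv sq x -> Tge t ex inv sq y ->
      kappa (x + y) = kappa x + kappa y /\ kappa (x * y) = kappa x * kappa y) ->
  kappa 1 = 1 -> kappa t = z -> kappa t^-1 = z^-1 ->
  (forall i, kappa (Mq (evec i)) = M (evec i)) ->
  (forall j, j \in ex :|: inv -> kappa (Mq (evec j))^-1 = (M (evec j))^-1) ->
  (* A_q = U_q *)
  (forall y, clusterAlg t ex inv sq y <-> upperAlg t ex inv sq y) ->
  (* kappa restricts to A_q ->> A_eps with kernel Phi_l(q^{1/2}) A_q *)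
  [/\ (forall x, clusterAlg t ex inv sq x -> clusterAlg z ex inv se (kappa x)),
      (forall y, clusterAlg z ex inv se y ->
         exists2 x, clusterAlg t ex inv sq x & kappa x = y) &
      (forall x, clusterAlg t ex inv sq x ->
         (kappa x = 0 <-> exists2 y, clusterAlg t ex inv sq y &
                                     x = peval (Cyclotomic l) t * y))].
Proof.
move=> l0 el skew d0 sB cB _ Fq_div ct fMq Fe_div cz ez fM sq se hom k1 kt ktV kx kxV AU.
have LB : compatible ex d L B by split.
split.
- exact: (kappa_clusterAlg l ex inv L B d Fq t Mq Fe z e M kappa).
- exact: (kappa_clusterAlg_surj l ex inv L B d Fq t Mq Fe z e M kappa).
- exact: (kappa_kernel l ex inv L B d Fq t Mq Fe z e M kappa).
Qed.
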